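(* Assume $\tau = \mathrm{SB}_{\mathcal A}(\Omega) > 0$. Let $x_k\in\Omega$, $g=-\nabla f(x_k)$, assume the SSC procedure with method $\mathcal A$ is given the input $(x_k,g)$, and let $x_{k+1}^{tr}$ be its output. Set $K=\tau/(L(1+\tau))$. Then there is a point $\tilde x_k\in\Omega$ with $$f(x_{k+1}^{tr})\le f(\tilde x_k)\le f(x_k)-\frac L2\|x_k-\tilde x_k\|^2$$ such that $$f(x_k)-f(x_{k+1}^{tr})\ \ge\ \frac L2\|x_k-x_{k+1}^{tr}\|^2,\qquad \|x_k-x_{k+1}^{tr}\|\ \ge\ K\,\|\pi(T_\Omega(\tilde x_k),-\nabla f(\tilde x_k))\|.$$ Furthermore, if $x_{k+1}\in\Omega$ is any point with $f(x_{k+1})\le\min\big(f(x_{k+1}^{tr}),\,f(x_k)-\frac L2\|x_{k+1}-x_k\|^2\big)$, then with $a=L/2$ and $b=1/K$ one has $$f(x_{k+1})+a\|x_{k+1}-x_k\|^2\le f(x_k),\qquad f(x_k)-f(x_{k+1})\ge\frac{a}{b^2}\|\pi(T_\Omega(\tilde x_k),-\nabla f(\tilde x_k))\|^2,$$ and $f(x_{k+1})\le f(\tilde x_k)\le f(x_k)-a\|\tilde x_k-x_k\|^2$.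
   Context: $\Omega\subset\mathbb R^n$ is nonempty, compact and convex; $f\in C^1(\Omega)$ satisfies $\|\nabla f(x)-\nabla f(y)\|\le L\|x-y\|$ for all $x,y\in\Omega$, with $L>0$. $T_\Omega(x)$ is the tangent cone of $\Omega$ at $x$, $\pi(C,\cdot)$ the Euclidean projection on a closed convex set $C$, $\pi_x(g)=\|\pi(T_\Omega(x),g)\|$, $\hat c=c/\|c\|$ for $c\neq0$ and $\hat 0=0$, and $\bar B_R(x)$ is the closed Euclidean ball. Method. A method $\mathcal A$ assigns to each $(x,g)\in\Omega\times\mathbb R^n$ a nonempty set of feasible directions $\mathcal A(x,g)\subset (T_\Omega(x)\cap\{y:\langle g,y\rangle>0\})\cup\{0\}$; $\mathcal A(x,g)=\{0\}$ if $x$ is stationary for the gradient $-g$ (i.e. $\pi_x(g)=0$), and $0\notin\mathcal A(x,g)$ otherwise. Slope bounds. $\mathrm{DSB}_{\mathcal A}(\Omega,x,g)=\inf_{d\in\mathcal A(x,g)}\frac{\langle g,d\rangle}{\pi_x(g)\|d\|}$ if $\pi_x(g)\ne0$ and $\mathrm{DSB}_{\mathcal A}(\Omega,x,g)=1$ otherwise; $\mathrm{SB}_{\mathcal A}(\Omega)=\inf_{x\in\Omega,\,g\in\mathbb R^n}\mathrm{DSB}_{\mathcal A}(\Omega,x,g)$. SSC procedure SSC$(\bar x,g)$. Set $y_0=\bar x$, $j=0$ and iterate. (I) Choose $d_j\in\mathcal A(y_j,g)$ and a maximal stepsize $\alpha_{\max}^{(j)}$; it is assumed that if $d_j\neq0$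 then $\alpha_{\max}^{(j)}>0$ and $y_j+\alpha d_j\in\Omega$ for all $\alpha\in[0,\alpha_{\max}^{(j)}]$. If $d_j=0$, return $y_j$. (II) Let $\Omega_j=\bar B_{\|g\|/(2L)}(\bar x+\frac{g}{2L})\cap\bar B_{\langle g,\hat d_j\rangle/L}(\bar x)$; set $\beta_j=0$ if $y_j\notin\Omega_j$ and $\beta_j=\max\{\beta\ge0: y_j+\beta d_j\in\Omega_j\}$ if $y_j\in\Omega_j$; let $\alpha_j=\min(\alpha_{\max}^{(j)},\beta_j)$. If $\alpha_j=0$, return $y_j$. (III) Set $y_{j+1}=y_j+\alpha_jd_j$. If $\alpha_j=\beta_j$, return $y_{j+1}$; otherwise increase $j$ by 1 and repeat from (I). *)

(* Defs.v *)
From HB Require Import structures.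
From mathcomp Require Import all_boot all_order all_algebra.
From mathcomp Require Import all_classical all_reals all_analysis.
Import Order.TTheory GRing.Theory Num.Theory.
Import numFieldNormedType.Exports.

Set Implicit Arguments.
Unset Strict Implicit.
Unset Printing Implicit Defensive.

Local Open Scope classical_set_scope.
Local Open Scope ring_scope.

(* The library norm `|u| on 'rV[R]_n is the sup norm; Euclidean lengths are
   written enorm u.  Both induce the same topology, so compact, closure,
   continuous and differentiable keep their usual meaning. *)
Definition dotp (R : realType) (n : nat) (u v : 'rV[R]_n) : R :=
  \sum_(i < n) u 0 i * v 0 i.

Definition enorm (R : realType) (n : nat) (u : 'rV[R]_n) : R :=
  Num.sqrt (dotp u u).

Definition eball (R : realType) (n : nat) (c : 'rV[R]_n) (r : R) :
    set 'rV[R]_n :=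
  [set y | enorm (y - c) <= r].

Definition normalize (R : realType) (n : nat) (c : 'rV[R]_n) : 'rV[R]_n :=
  if c == 0 then 0 else (enorm c)^-1 *: c.

Definition grad (R : realType) (n : nat) (f : 'rV[R]_n -> R) (x : 'rV[R]_n) :
    'rV[R]_n :=
  \row_(i < n) 'D_(delta_mx 0 i) f x.

(* f is differentiable as a function on R^n at the points of Omega, which may
   have empty interior: the gradient is the full one, not one relative to
   Omega.  Any f that is C^1 on an open neighbourhood of Omega qualifies. *)
Definition C1_on (R : realType) (n : nat) (Omega : set 'rV[R]_n)
    (f : 'rV[R]_n -> R) : Prop :=
  (forall x, Omega x -> differentiable f x) /\ {within Omega, continuous (grad f)}.

(* Tangent cone of a convex set: the closure of the cone of feasible
   directions. *)
Definition tangent_cone (R : realType) (n : nat) (Omega : set 'rV[R]_n)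
    (x : 'rV[R]_n) : set 'rV[R]_n :=
  closure [set t *: (y - x) | t in [set t : R | 0 <= t] & y in Omega].

(* The nearest point of C is unique when C is nonempty, closed and convex; the
   default value 0 is never reached in that case. *)
Definition eproj (R : realType) (n : nat) (C : set 'rV[R]_n) (x : 'rV[R]_n) :
    'rV[R]_n :=
  xget 0 [set y | C y /\ forall z, C z -> enorm (x - y) <= enorm (x - z)].

Definition tproj_norm (R : realType) (n : nat) (Omega : set 'rV[R]_n)
    (x g : 'rV[R]_n) : R :=
  enorm (eproj (tangent_cone Omega x) g).

Definition is_method (R : realType) (n : nat) (Omega : set 'rV[R]_n)
    (A : 'rV[R]_n -> 'rV[R]_n -> set 'rV[R]_n) : Prop :=
  forall x g, Omega x ->
    [/\ A x g !=set0,
        A x g `<=` (tangent_cone Omega x `&` [set y | 0 < dotp g y]) `|` [set 0],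
        tproj_norm Omega x g = 0 -> A x g = [set 0]
      & tproj_norm Omega x g <> 0 -> ~ A x g 0].

(* For a method, the sets in DSB (when the projected norm is nonzero) and SB
   (when Omega is nonempty) are nonempty and bounded below by 0, so the real
   infimum inf is the true one. *)
Definition DSB (R : realType) (n : nat)
    (A : 'rV[R]_n -> 'rV[R]_n -> set 'rV[R]_n) (Omega : set 'rV[R]_n)
    (x g : 'rV[R]_n) : R :=
  if tproj_norm Omega x g == 0 then 1
  else inf [set dotp g d / (tproj_norm Omega x g * enorm d) | d in A x g].

Definition SB (R : realType) (n : nat)
    (A : 'rV[R]_n -> 'rV[R]_n -> set 'rV[R]_n) (Omega : set 'rV[R]_n) : R :=
  inf [set DSB A Omega x g | x in Omega & g in [set: 'rV[R]_n]].

Definition max_step (R : realType) (n : nat) (Omega : set 'rV[R]_n)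
    (y d : 'rV[R]_n) (amax : R) : Prop :=
  0 < amax /\ forall a : R, 0 <= a <= amax -> Omega (y + a *: d).

Definition ssc_region (R : realType) (n : nat) (L : R) (xbar g d : 'rV[R]_n) :
    set 'rV[R]_n :=
  eball (xbar + (2 * L)^-1 *: g) (enorm g / (2 * L))
  `&` eball xbar (dotp g (normalize d) / L).

Definition is_beta (R : realType) (n : nat) (L : R) (xbar g y d : 'rV[R]_n)
    (beta : R) : Prop :=
  let B := [set b : R | 0 <= b /\ ssc_region L xbar g d (y + b *: d)] in
  (ssc_region L xbar g d y -> B beta /\ ubound B beta) /\
  (~ ssc_region L xbar g d y -> beta = 0).

(* ssc_from A Omega L xbar g y z: some run of the loop whose current iterate is
   y terminates (after finitely many iterations) and returns z.  The direction
   and the maximal stepsize are arbitrary admissible choices at each iteration;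
   the constructors are the four possible outcomes of one iteration. *)
Inductive ssc_from (R : realType) (n : nat)
    (A : 'rV[R]_n -> 'rV[R]_n -> set 'rV[R]_n) (Omega : set 'rV[R]_n) (L : R)
    (xbar g : 'rV[R]_n) : 'rV[R]_n -> 'rV[R]_n -> Prop :=
| ssc_zero_dir y :
    A y g 0 -> ssc_from A Omega L xbar g y y
| ssc_zero_step y d amax beta :
    A y g d -> d <> 0 -> max_step Omega y d amax -> is_beta L xbar g y d beta ->
    Num.min amax beta = 0 ->
    ssc_from A Omega L xbar g y y
| ssc_exit y d amax beta :
    A y g d -> d <> 0 -> max_step Omega y d amax -> is_beta L xbar g y d beta ->
    Num.min amax beta <> 0 -> Num.min amax beta = beta ->
    ssc_from A Omega L xbar g y (y + Num.min amax beta *: d)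
| ssc_continue y d amax beta z :
    A y g d -> d <> 0 -> max_step Omega y d amax -> is_beta L xbar g y d beta ->
    Num.min amax beta <> 0 -> Num.min amax beta <> beta ->
    ssc_from A Omega L xbar g (y + Num.min amax beta *: d) z ->
    ssc_from A Omega L xbar g y z.

Definition ssc_output (R : realType) (n : nat)
    (A : 'rV[R]_n -> 'rV[R]_n -> set 'rV[R]_n) (Omega : set 'rV[R]_n) (L : R)
    (xbar g z : 'rV[R]_n) : Prop :=
  ssc_from A Omega L xbar g xbar z.

(* Main.v *)
Require Import Defs.
From HB Require Import structures.
From mathcomp Require Import all_boot all_order all_algebra.
From mathcomp Require Import all_classical all_reals all_analysis.
From mathcomp Require Import ring lra.
Import Order.TTheory GRing.Theory Num.Theory.
Import numFieldNormedType.Exports.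

Local Open Scope classical_set_scope.
Local Open Scope ring_scope.

Set Implicit Arguments.
Unset Strict Implicit.
Unset Printing Implicit Defensive.

(** Write x for the starting point, g = - grad f x and tau for the slope bound.

The constraint that an iterate y lie in the ball with diameter
[x, x + g / L] amounts to L |y - x|^2 <= <g, y - x> ([mem_gradient_ball]), and
the descent lemma for gradients that are L-Lipschitz then gives
f y <= f x - (L / 2) |y - x|^2. All iterates satisfy this constraint, which
settles every quadratic decrease in the theorem. The other constraint,
|y - x| <= <g, d> / (L |d|), makes d a direction of nonincrease of f at every
point where it holds, as the gradients at x and y differ by at most L |y - x|
([slope_nonincreasing]). Hence f never increases along the run.

The bound on the projected gradient rests on a particular point of the run. At
an iterate w left along the direction d, write r = <g, d> / |d|. Then
L |w - x| <= r because w is in the second ball, and tau pi_w(g) <= r by the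
definition of tau ([anchor_slope]). If moreover r <= L |z - x| for the output z,
then w is the point sought: projecting onto a cone is 1-Lipschitz in length
([tproj_norm_le]), so pi_w(- grad f w) <= pi_w(g) + L |w - x|
<= (1 / tau + 1) L |z - x|. When the run ends with a step that the balls limit,
one of the two ball constraints blocks it ([is_beta_active]). When it is the second, r <= L |z - x| holds
for the last direction. When it is the first, z lies on the sphere
L |z - x|^2 = <g, z - x>; as z - x is a sum of steps, each with slope along g
at least the smallest value r of <g, d> / |d| met so far, we get
<g, z - x> >= r |z - x| and again r <= L |z - x|, where w is now the iterate at
which the smallest slope was used. The pair (w, r) is therefore carried along
the run ([run_invariant]), and [ssc_output_anchor] collects the four ways in
which the run may end. *)

(** * Euclidean geometry *)

Lemma dotpC (R : realType) (n : nat) (u v : 'rV[R]_n) : dotp u v = dotp v u.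
Proof. by apply: eq_bigr => i _; rewrite mulrC. Qed.

Lemma dotpDl (R : realType) (n : nat) (u v w : 'rV[R]_n) :
  dotp (u + v) w = dotp u w + dotp v w.
Proof. by rewrite -big_split; apply: eq_bigr => i _; rewrite mxE mulrDl. Qed.

Lemma dotpZl (R : realType) (n : nat) (a : R) (u v : 'rV[R]_n) :
  dotp (a *: u) v = a * dotp u v.
Proof. by rewrite mulr_sumr; apply: eq_bigr => i _; rewrite mxE mulrA. Qed.

Lemma dotpDr (R : realType) (n : nat) (u v w : 'rV[R]_n) :
  dotp u (v + w) = dotp u v + dotp u w.
Proof. by rewrite dotpC dotpDl !(dotpC u). Qed.

Lemma dotpZr (R : realType) (n : nat) (a : R) (u v : 'rV[R]_n) :
  dotp u (a *: v) = a * dotp u v.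
Proof. by rewrite dotpC dotpZl dotpC. Qed.

Lemma dotpNl (R : realType) (n : nat) (u v : 'rV[R]_n) :
  dotp (- u) v = - dotp u v.
Proof. by rewrite -scaleN1r dotpZl mulN1r. Qed.

Lemma dotpNr (R : realType) (n : nat) (u v : 'rV[R]_n) :
  dotp u (- v) = - dotp u v.
Proof. by rewrite dotpC dotpNl dotpC. Qed.

Lemma dotp0r (R : realType) (n : nat) (u : 'rV[R]_n) : dotp u 0 = 0.
Proof. by rewrite -(scale0r 0) dotpZr mul0r. Qed.

Lemma dotp_ge0 (R : realType) (n : nat) (u : 'rV[R]_n) : 0 <= dotp u u.
Proof. by apply: sumr_ge0 => i _; rewrite -expr2 sqr_ge0. Qed.

Lemma dotp_eq0 (R : realType) (n : nat) (u : 'rV[R]_n) : dotp u u = 0 -> u = 0.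
Proof.
move=> u0; apply/rowP => i; rewrite mxE; apply/eqP.
rewrite -sqrf_eq0 expr2; apply/eqP.
by apply: (psumr_eq0P _ u0) => // j _; rewrite -expr2 sqr_ge0.
Qed.

Definition dotpE := (dotpDl, dotpDr, dotpNl, dotpNr, dotpZl, dotpZr).

Lemma sqr_enorm (R : realType) (n : nat) (u : 'rV[R]_n) :
  enorm u ^+ 2 = dotp u u.
Proof. by rewrite sqr_sqrtr ?dotp_ge0. Qed.

Lemma enorm_ge0 (R : realType) (n : nat) (u : 'rV[R]_n) : 0 <= enorm u.
Proof. exact: sqrtr_ge0. Qed.

Lemma enorm_eq0 (R : realType) (n : nat) (u : 'rV[R]_n) : enorm u = 0 -> u = 0.
Proof. by move=> u0; apply: dotp_eq0; rewrite -sqr_enorm u0 expr0n. Qed.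

Lemma enorm0 (R : realType) (n : nat) : enorm (0 : 'rV[R]_n) = 0.
Proof. by rewrite /enorm dotp0r sqrtr0. Qed.

Lemma enorm_gt0 (R : realType) (n : nat) (u : 'rV[R]_n) :
  u <> 0 -> 0 < enorm u.
Proof.
by rewrite lt_def enorm_ge0 andbT => u0; apply/eqP => /enorm_eq0.
Qed.

Lemma enormZ (R : realType) (n : nat) (a : R) (u : 'rV[R]_n) :
  0 <= a -> enorm (a *: u) = a * enorm u.
Proof.
move=> a0; rewrite /enorm dotpZl dotpZr mulrA -expr2 sqrtrM ?sqr_ge0//.
by rewrite sqrtr_sqr ger0_norm.
Qed.

Lemma enormN (R : realType) (n : nat) (u : 'rV[R]_n) : enorm (- u) = enorm u.
Proof. by rewrite /enorm dotpNl dotpNr opprK. Qed.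

Lemma enorm_distC (R : realType) (n : nat) (u v : 'rV[R]_n) :
  enorm (u - v) = enorm (v - u).
Proof. by rewrite -enormN opprB. Qed.

Lemma enorm_le (R : realType) (n : nat) (u : 'rV[R]_n) (r : R) :
  0 <= r -> (enorm u <= r) = (dotp u u <= r ^+ 2).
Proof. by move=> r0; rewrite -sqr_enorm ler_sqr ?nnegrE ?enorm_ge0. Qed.

(** Expanding the square of the vector |v| u - |u| v. *)
Lemma cauchy_schwarz (R : realType) (n : nat) (u v : 'rV[R]_n) :
  dotp u v <= enorm u * enorm v.
Proof.
have [->|/eqP /enorm_gt0 u0] := eqVneq u 0.
  by rewrite dotpC dotp0r enorm0 mul0r.
have [->|/eqP /enorm_gt0 v0] := eqVneq v 0; first by rewrite dotp0r enorm0 mulr0.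
have := dotp_ge0 (enorm v *: u - enorm u *: v).
rewrite !dotpE (dotpC v u) -!sqr_enorm => h.
rewrite -(ler_pM2l (mulr_gt0 u0 v0)); nra.
Qed.

Lemma enorm_triangle (R : realType) (n : nat) (u v : 'rV[R]_n) :
  enorm (u + v) <= enorm u + enorm v.
Proof.
rewrite enorm_le ?addr_ge0 ?enorm_ge0//.
rewrite !dotpE (dotpC v u) -!sqr_enorm.
have := cauchy_schwarz u v; nra.
Qed.

Lemma le_sup_enorm (R : realType) (n : nat) (u : 'rV[R]_n) : `|u| <= enorm u.
Proof.
rewrite /Num.norm /= mx_normrE; apply: bigmax_le; first exact: enorm_ge0.
move=> [i j] _ /=; rewrite (ord1 i) -sqrtr_sqr ler_wsqrtr//.
rewrite expr2 /dotp (bigD1 j)//= lerDl.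
by apply: sumr_ge0 => k _; rewrite -expr2 sqr_ge0.
Qed.

(** * Projection onto closed cones *)

Lemma continuous_dist2 (R : realType) (n : nat) (x : 'rV[R]_n) :
  continuous (fun z : 'rV[R]_n => dotp (x - z) (x - z)).
Proof.
move=> z; apply: (@cvg_big R^o 'I_n +%R 0 xpredT (@add_continuous R^o) _ _ _
  (fun i z => (x - z) 0 i * (x - z) 0 i) _ (nbhs_filter z)) => i _.
have xzc : (x - w) 0 i @[w --> z] --> (x - z) 0 i.
  apply: (@cvg_comp _ _ _ (fun w => x - w) (fun w : 'rV[R]_n => w 0 i)).
    apply: (@cvgB _ _ _ _ (nbhs_filter z) (cst x) id x z).
      exact: cvg_cst.
    exact: cvg_id.
  exact: coord_continuous.
exact: cvgM.
Qed.

(** The points of [C] no farther from [x] than a given one form a compact set, on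
which the distance attains its minimum. *)
Lemma eprojP (R : realType) (n : nat) (C : set 'rV[R]_n) (x : 'rV[R]_n) :
  closed C -> C !=set0 ->
  C (eproj C x) /\ forall z, C z -> enorm (x - eproj C x) <= enorm (x - z).
Proof.
move=> Ccl [z0 Cz0].
suff ex : exists y, C y /\ forall z, C z -> enorm (x - y) <= enorm (x - z).
  exact: (xgetPex 0 ex).
pose f (z : 'rV[R]_n) := dotp (x - z) (x - z).
pose D := C `&` f @^-1` [set r | r <= f z0].
have Dcl : closed D.
  apply: closedI => //.
  apply: (@closed_comp _ R^o f); last exact: closed_le.
  by move=> z _; exact: continuous_dist2.
have Dbd : bounded_set D.
  exists (`|x| + enorm (x - z0)); split; first exact: num_real.
  move=> M ltM z [_ fz]; apply: (le_trans _ (ltW ltM)).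
  rewrite -[z in leLHS](subKr x) (le_trans (ler_normB _ _))// lerD2l.
  apply: (le_trans (le_sup_enorm _)).
  by rewrite enorm_le ?enorm_ge0// sqr_enorm.
have Dn0 : D !=set0 by exists z0; split => //=.
have [|c /set_mem [Cc _] cmin] :=
    EVT_min_rV Dn0 (bounded_closed_compact Dbd Dcl) (f := f).
  exact/continuous_subspaceT/continuous_dist2.
exists c; split => // z Cz; rewrite enorm_le ?enorm_ge0// sqr_enorm.
have [fz|/ltW fz] := leP (f z) (f z0); first by apply: cmin; rewrite inE.
by apply: (le_trans _ fz); apply: cmin; rewrite inE; split => //=.
Qed.


(** The projection p of [a] also minimizes the distance to [a] along the ray that p
spans, so the derivative of |a - s p|^2 vanishes at s = 1. *)
Lemma dotp_eproj_cone (R : realType) (n : nat) (C : set 'rV[R]_n)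
    (a : 'rV[R]_n) :
  closed C -> C 0 -> (forall t z, 0 <= t -> C z -> C (t *: z)) ->
  dotp a (eproj C a) = enorm (eproj C a) ^+ 2.
Proof.
move=> Ccl C0 Ccone; have [Cp pmin] := eprojP a Ccl (ex_intro _ _ C0).
set p := eproj C a in Cp pmin *.
have [->|/eqP /enorm_gt0 p0] := eqVneq p 0; first by rewrite dotp0r enorm0 expr0n.
have q s : 0 <= s ->
    enorm p ^+ 2 - 2 * dotp a p <= s ^+ 2 * enorm p ^+ 2 - 2 * s * dotp a p.
  move=> s0; have := pmin _ (Ccone s _ s0 Cp).
  rewrite enorm_le ?enorm_ge0// sqr_enorm !dotpE (dotpC p a) sqr_enorm; lra.
have r0 : 0 <= dotp a p.
  by have := q 0 (lexx _); have := sqr_ge0 (enorm p); lra.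
have m0 : 0 < enorm p ^+ 2 by rewrite exprn_gt0.
(* The minimum over the ray is attained at this value of s. *)
have := q _ (divr_ge0 r0 (ltW m0)).
move: (dotp a p) (enorm p ^+ 2) m0 => r m m0.
have -> : (r / m) ^+ 2 * m - 2 * (r / m) * r = - (r ^+ 2 / m).
  by field; rewrite gt_eqF.
have -> : - (r ^+ 2 / m) = m - 2 * r - (r - m) ^+ 2 / m.
  by field; rewrite gt_eqF.
rewrite lerBrDr gerDl pmulr_lle0 ?invr_gt0// => h.
by apply/eqP; rewrite -subr_eq0 -sqrf_eq0 eq_le h sqr_ge0.
Qed.

(** The squared distance from [a] to the ray through [z] is
|a|^2 - <a, z>^2 / |z|^2, and it is at least |a|^2 - |p|^2, where p is the
projection of [a]. *)
Lemma dotp_le_eproj_cone (R : realType) (n : nat) (C : set 'rV[R]_n)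
    (a z : 'rV[R]_n) :
  closed C -> C 0 -> (forall t z, 0 <= t -> C z -> C (t *: z)) ->
  C z -> dotp a z <= enorm (eproj C a) * enorm z.
Proof.
move=> Ccl C0 Ccone Cz; have [Cp pmin] := eprojP a Ccl (ex_intro _ _ C0).
have ap := dotp_eproj_cone a Ccl C0 Ccone.
set p := eproj C a in Cp pmin ap *.
have [/le_trans -> //|az0] := leP (dotp a z) 0.
  by rewrite mulr_ge0 ?enorm_ge0.
have /enorm_gt0 z0 : z <> 0 by move=> zE; rewrite zE dotp0r ltxx in az0.
have m0 : 0 < enorm z ^+ 2 by rewrite exprn_gt0.
have s0 : 0 <= dotp a z / enorm z ^+ 2 by rewrite ltW ?divr_gt0.
have := pmin _ (Ccone _ _ s0 Cz).
rewrite enorm_le ?enorm_ge0// sqr_enorm !dotpE (dotpC p a) (dotpC z a) ap.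
rewrite -(sqr_enorm p) -(sqr_enorm z) => h.
rewrite -ler_sqr ?nnegrE ?mulr_ge0 ?enorm_ge0 ?(ltW az0)// exprMn.
rewrite -ler_pdivrMr//.
have sz : dotp a z / enorm z ^+ 2 * enorm z ^+ 2 = dotp a z.
  by rewrite divfK// gt_eqF.
have -> : dotp a z ^+ 2 / enorm z ^+ 2 = dotp a z / enorm z ^+ 2 * dotp a z.
  by rewrite expr2 mulrAC.
rewrite sz in h; lra.
Qed.

(** The length of the projection of [a] is the supremum of <a, z> over the
vectors z of the cone with |z| <= 1, hence 1-Lipschitz in [a]. *)
Lemma enorm_eproj_cone_le (R : realType) (n : nat) (C : set 'rV[R]_n)
    (a b : 'rV[R]_n) :
  closed C -> C 0 -> (forall t z, 0 <= t -> C z -> C (t *: z)) ->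
  enorm (eproj C a) <= enorm (eproj C b) + enorm (a - b).
Proof.
move=> Ccl C0 Ccone; have [Cp _] := eprojP a Ccl (ex_intro _ _ C0).
have ap := dotp_eproj_cone a Ccl C0 Ccone.
have bp := dotp_le_eproj_cone b Ccl C0 Ccone Cp.
have cs := cauchy_schwarz (a - b) (eproj C a).
have [->|/eqP /enorm_gt0 p0] := eqVneq (eproj C a) 0.
  by rewrite enorm0 addr_ge0 ?enorm_ge0.
have := dotpDl (a - b) b (eproj C a); rewrite subrK => apE.
rewrite -(ler_pM2r p0) -expr2 -ap apE mulrDl; lra.
Qed.

Lemma tangent_cone_0 (R : realType) (n : nat) (Omega : set 'rV[R]_n)
    (x : 'rV[R]_n) :
  Omega x -> tangent_cone Omega x 0.
Proof.
move=> Ox; apply: subset_closure; exists 0 => //=.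
by exists x => //; rewrite scale0r.
Qed.

Lemma tangent_cone_scale (R : realType) (n : nat) (Omega : set 'rV[R]_n)
    (x z : 'rV[R]_n) (t : R) :
  0 <= t -> tangent_cone Omega x z -> tangent_cone Omega x (t *: z).
Proof.
move=> t0 Tz B /(@scaler_continuous R _ t z) /Tz [_ [[s s0 [y Oy <-]] By]].
exists (t *: (s *: (y - x))); split => //.
by exists (t * s); [exact: mulr_ge0|exists y => //; rewrite scalerA].
Qed.

Lemma tproj_norm_le (R : realType) (n : nat) (Omega : set 'rV[R]_n)
    (x a b : 'rV[R]_n) :
  Omega x -> tproj_norm Omega x a <= tproj_norm Omega x b + enorm (a - b).
Proof.
move=> Ox; apply: enorm_eproj_cone_le; first exact: closed_closure.
  exact: tangent_cone_0.
by move=> t z; exact: tangent_cone_scale.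
Qed.

(** * Differentiable functions along segments *)

Lemma deriveE_grad (R : realType) (n : nat) (f : 'rV[R]_n -> R)
    (x v : 'rV[R]_n) :
  differentiable f x -> 'D_v f x = dotp (grad f x) v.
Proof.
move=> df; rewrite deriveE// [v in LHS]row_sum_delta linear_sum.
by apply: eq_bigr => i _; rewrite linearZ /= mxE deriveE// mulrC.
Qed.

Lemma is_derive_along (R : realType) (n : nat) (f : 'rV[R]_n -> R)
    (x v : 'rV[R]_n) (t : R) :
  differentiable f (x + t *: v) ->
  is_derive t 1 (fun s : R => f (x + s *: v)) (dotp (grad f (x + t *: v)) v).
Proof.
move=> df.
have quot : (fun h : R => h^-1 *:
      (((fun s : R => f (x + s *: v)) \o shift t) (h *: 1) - f (x + t *: v))) =
    (fun h : R => h^-1 *: ((f \o shift (x + t *: v)) (h *: v) - f (x + t *: v))).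
  apply/funext => h /=; congr (_ *: (f _ - _)).
  by rewrite [h%:A]mulr1 scalerDl addrCA.
split; rewrite /derivable /derive quot; first exact: diff_derivable.
exact: deriveE_grad.
Qed.

(** The mean value theorem for f (x + t v) minus the primitive of its slope
bound. *)
Lemma le_along_segment (R : realType) (n : nat) (f : 'rV[R]_n -> R)
    (x v : 'rV[R]_n) (c0 c1 : R) :
  (forall t : R, 0 <= t <= 1 -> differentiable f (x + t *: v)) ->
  (forall t : R, 0 <= t <= 1 -> dotp (grad f (x + t *: v)) v <= c0 + c1 * t) ->
  f (x + v) <= f x + c0 + c1 / 2.
Proof.
move=> df le_slope.
pose phi (t : R) := f (x + t *: v) - (c0 * t + c1 / 2 * t ^+ 2).
have dphi (t : R) : 0 <= t <= 1 ->
    is_derive t 1 phi (dotp (grad f (x + t *: v)) v - (c0 + c1 * t)).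
  move=> t01; have := is_derive_along (df t t01) => dft.
  apply: is_derive_eq; rewrite /= /GRing.scale /=; lra.
have cphi : {within `[0, 1], continuous phi}.
  apply: derivable_within_continuous => t; rewrite in_itv /= => t01.
  by have := dphi t t01 => ?; exact: ex_derive.
have [|c] := MVT ltr01 _ cphi
    (df := fun t => dotp (grad f (x + t *: v)) v - (c0 + c1 * t)).
  by move=> t; rewrite in_itv /= => /andP[t0 t1]; apply: dphi; rewrite !ltW.
rewrite in_itv /= => /andP[c_gt0 c_lt1].
have := le_slope c; rewrite (ltW c_gt0) (ltW c_lt1) => /(_ isT).
rewrite /phi scale1r scale0r addr0; lra.
Qed.

Lemma convex_segment (R : realType) (n : nat) (Omega : set 'rV[R]_n)
    (x y : 'rV[R]_n) (t : R) :
  convex_set (Omega : set (convex_lmodType 'rV[R]_n)) ->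
  Omega x -> Omega y -> 0 <= t <= 1 -> Omega (x + t *: (y - x)).
Proof.
move=> cvx Ox Oy /andP[t0 t1].
have t01 : (0 <= t) && (t <= 1) by rewrite t0 t1.
have := cvx y x (Itv01 t0 t1); rewrite !inE => /(_ Oy Ox).
have -> // : x + t *: (y - x) = t *: y + (1 - t) *: x.
by rewrite scalerBr scalerBl scale1r addrCA.
Qed.

Lemma descent_lemma (R : realType) (n : nat) (Omega : set 'rV[R]_n)
    (f : 'rV[R]_n -> R) (L : R) (x y : 'rV[R]_n) :
  convex_set (Omega : set (convex_lmodType 'rV[R]_n)) ->
  (forall x, Omega x -> differentiable f x) ->
  (forall x y, Omega x -> Omega y ->
    enorm (grad f x - grad f y) <= L * enorm (x - y)) ->
  Omega x -> Omega y ->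
  f y <= f x + dotp (grad f x) (y - x) + L / 2 * enorm (y - x) ^+ 2.
Proof.
move=> cvx df lip Ox Oy.
have seg t t01 := convex_segment (t := t) cvx Ox Oy t01.
have -> : L / 2 * enorm (y - x) ^+ 2 = L * enorm (y - x) ^+ 2 / 2 by lra.
rewrite -[y in f y](subrK x) [y - x + x]addrC.
apply: le_along_segment => t t01; first exact/df/seg.
rewrite -[grad f (_ + _)](subrK (grad f x)) dotpDl addrC lerD2l.
apply: (le_trans (cauchy_schwarz _ _)).
have := lip _ _ (seg t t01) Ox; rewrite [x + _ - x]addrAC subrr add0r.
have /andP[t0 _] := t01; rewrite enormZ// => h.
have := ler_wpM2r (enorm_ge0 (y - x)) h; lra.
Qed.

(** * The two balls that control a step *)

Lemma small_step_ge0 (R : realType) (p r s : R) :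
  0 < p -> exists2 e0, 0 < e0 &
    forall e, 0 < e <= e0 -> 0 <= p + e * r + e ^+ 2 * s.
Proof.
move=> p0; have q0 : 0 < p + `|r| + `|s|.
  by have := normr_ge0 r; have := normr_ge0 s; lra.
exists (p / (p + `|r| + `|s|)); first exact: divr_gt0.
move=> e /andP[e0]; rewrite ler_pdivlMr// => le_p.
have := ler_norm (- r); have := ler_norm (- s); rewrite !normrN => s1 r1.
have := normr_ge0 r; have := normr_ge0 s => s2 r2.
have e1 : e <= 1 by nra.
have : e * - r <= e * `|r| by rewrite ler_pM2l.
have : e ^+ 2 * - s <= e * `|s|.
  rewrite expr2 -mulrA ler_pM2l//; nra.
nra.
Qed.

(** This ball has diameter [x, x + g / L]: membership says that
<(y - x) - g / L, y - x> <= 0. *)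
Lemma mem_gradient_ball (R : realType) (n : nat) (L : R) (x g y : 'rV[R]_n) :
  0 < L ->
  eball (x + (2 * L)^-1 *: g) (enorm g / (2 * L)) y <->
  L * enorm (y - x) ^+ 2 <= dotp g (y - x).
Proof.
move=> L0; rewrite /eball /=.
have L0' : L != 0 by rewrite gt_eqF.
have r0 : 0 <= enorm g / (2 * L) by rewrite divr_ge0 ?enorm_ge0//; lra.
rewrite enorm_le// opprD addrA.
move: (y - x) => w; rewrite exprMn !dotpE (dotpC w g) -!sqr_enorm.
rewrite -subr_ge0 -[X in _ <-> is_true X]subr_ge0.
rewrite [X in is_true (0 <= X) <-> _](_ : _ = L^-1 * (dotp g w - L * enorm w ^+ 2)).
  by rewrite pmulr_rge0 ?invr_gt0.
by field.
Qed.

Lemma eball_segment (R : realType) (n : nat) (c y d : 'rV[R]_n) (r a b : R) :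
  0 <= a <= b -> eball c r y -> eball c r (y + b *: d) -> eball c r (y + a *: d).
Proof.
rewrite /eball /= => /andP[a0 ab] yr ydr.
have [b0|b0] := leP b 0.
  have -> : a = 0 by lra.
  by rewrite scale0r addr0.
have -> : y + a *: d - c =
    (1 - a / b) *: (y - c) + (a / b) *: (y + b *: d - c).
  rewrite [y + b *: d - c]addrAC [(a / b) *: (_ + _)]scalerDr addrA.
  rewrite -scalerDl subrK scale1r.
  by rewrite scalerA divfK ?gt_eqF// addrAC.
have ab0 : 0 <= a / b by rewrite divr_ge0// ltW.
have ab1 : 0 <= 1 - a / b by rewrite subr_ge0 ler_pdivrMr// mul1r.
apply: (le_trans (enorm_triangle _ _)); rewrite !enormZ//.
have := ler_wpM2l ab0 ydr; have := ler_wpM2l ab1 yr; lra.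
Qed.

Lemma dotp_normalize (R : realType) (n : nat) (g d : 'rV[R]_n) :
  d <> 0 -> dotp g (normalize d) * enorm d = dotp g d.
Proof.
move=> d0; rewrite /normalize; case: eqP => // _.
by rewrite dotpZr mulrAC mulVf ?mul1r// gt_eqF// enorm_gt0.
Qed.

(** If both constraints were slack at the endpoint, a slightly longer step would
still satisfy them. An endpoint equal to [x] lies on the boundary of the first
ball, but [d] points to the interior there since 0 < <g, d>, so a longer step is possible
in that case too; this is why the second alternative excludes it. *)
Lemma is_beta_active (R : realType) (n : nat) (L : R) (x g y d : 'rV[R]_n)
    (b : R) :
  0 < L -> 0 < dotp g d -> ssc_region L x g d y -> is_beta L x g y d b ->
  dotp g (normalize d) / L <= enorm (y + b *: d - x) \/
  (y + b *: d <> x /\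
   dotp g (y + b *: d - x) <= L * enorm (y + b *: d - x) ^+ 2).
Proof.
move=> L0 gd0 yin [/(_ yin) [[b0 _] bmax] _].
set c := dotp g (normalize d) / L.
have [|ltc] := leP c (enorm (y + b *: d - x)); [by left|right].
have c0 : 0 <= c by apply: le_trans (enorm_ge0 _) (ltW ltc).
have step e : y + (b + e) *: d - x = (y + b *: d - x) + e *: d.
  by rewrite scalerDl addrA [LHS]addrAC.
move: (y + b *: d - x) (step) ltc (subr_eq0 (y + b *: d) x) => w {}step ltc wE.
(* [w] is the displacement from the centre; the side conditions on a further
   step e are polynomials of degree 2 in e, positive at 0 or with positive slope. *)
have [|e2 e20 ball_ok] := @small_step_ge0 _ (c ^+ 2 - enorm w ^+ 2)
    (- 2 * dotp w d) (- enorm d ^+ 2).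
  by rewrite subr_gt0 ltr_sqr ?nnegrE ?enorm_ge0.
have no_step e1 : 0 < e1 -> (forall e, 0 < e <= e1 ->
    L * enorm (w + e *: d) ^+ 2 <= dotp g (w + e *: d)) -> False.
  move=> e10 grad_ok; pose e := Num.min e1 e2.
  have e0 : 0 < e by rewrite lt_min e10 e20.
  suff be : b + e <= b by move: be; rewrite gerDl leNgt e0.
  apply: bmax; split; first by rewrite addr_ge0// ltW.
  split.
    by apply/mem_gradient_ball => //; rewrite step grad_ok// e0 ge_min lexx.
  rewrite /eball /= step -/c enorm_le// !dotpE (dotpC d w) -!sqr_enorm.
  have := ball_ok e; rewrite e0 ge_min lexx orbT => /(_ isT); lra.
split.
  move=> /eqP; rewrite -wE => /eqP w0.
  have [e1 e10 ok] := @small_step_ge0 _ _ (- (L * enorm d ^+ 2)) 0 gd0.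
  apply: (no_step e1 e10) => e e1e; rewrite w0 add0r dotpZr.
  have /andP[/ltW e0 _] := e1e; rewrite enormZ//.
  have := mulr_ge0 e0 (ok e e1e); lra.
have [//|gap] := leP (dotp g w) (L * enorm w ^+ 2).
rewrite -subr_gt0 in gap.
have [e1 e10 ok] := @small_step_ge0 _ _ (dotp g d - 2 * L * dotp w d)
  (- (L * enorm d ^+ 2)) gap.
exfalso; apply: (no_step e1 e10) => e e1e.
rewrite sqr_enorm !dotpE (dotpC d w) -!sqr_enorm.
have := ok e e1e; lra.
Qed.

Lemma method_slope (R : realType) (n : nat) (Omega : set 'rV[R]_n)
    (A : 'rV[R]_n -> 'rV[R]_n -> set 'rV[R]_n) (y g d : 'rV[R]_n) :
  is_method Omega A -> Omega y -> A y g d -> d <> 0 ->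
  0 < dotp g d /\ SB A Omega * tproj_norm Omega y g <= dotp g (normalize d).
Proof.
move=> mA Oy Ad d0.
have dsb_ge0 z h : Omega z ->
    lbound [set dotp h e / (tproj_norm Omega z h * enorm e) | e in A z h] 0.
  move=> Oz _ [e Ae <-]; have [_ sub _ _] := mA z h Oz.
  rewrite divr_ge0 ?mulr_ge0 ?enorm_ge0//.
  by case: (sub _ Ae) => [[_ /ltW]|->]; rewrite ?dotp0r.
have [_ sub stat _] := mA y g Oy.
have gd0 : 0 < dotp g d by case: (sub _ Ad) => [[]|/d0].
split => //.
have pi0 : tproj_norm Omega y g != 0.
  by apply/eqP => /stat AE; move: Ad; rewrite AE => /d0.
have SB_le : SB A Omega <= DSB A Omega y g.
  apply: ge_inf; last by exists y => //; exists g.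
  exists 0 => _ [z Oz [h _ <-]]; rewrite /DSB; case: ifP => // _.
  apply: lb_le_inf; last exact: dsb_ge0.
  by have [[e Ae] _ _ _] := mA z h Oz;
    exists (dotp h e / (tproj_norm Omega z h * enorm e)), e.
have DSB_le : DSB A Omega y g <= dotp g d / (tproj_norm Omega y g * enorm d).
  rewrite /DSB (negPf pi0); apply: ge_inf; last by exists d.
  by exists 0; exact: dsb_ge0.
have pi_gt0 : 0 < tproj_norm Omega y g by rewrite lt_def pi0 enorm_ge0.
rewrite -ler_pdivlMr//; apply: (le_trans SB_le); apply: (le_trans DSB_le).
by rewrite -(dotp_normalize g d0) -mulf_div divff ?mulr1// gt_eqF ?enorm_gt0.
Qed.

(** The derivative of [f] along [d] is at most that at [x], which is
- <- grad f x, d>, plus the variation L |y + t d - x| |d| of the gradient; the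
ball bounds the latter by the former. *)
Lemma slope_nonincreasing (R : realType) (n : nat) (Omega : set 'rV[R]_n)
    (f : 'rV[R]_n -> R) (L : R) (x y d : 'rV[R]_n) (a : R) :
  0 < L -> (forall x, Omega x -> differentiable f x) ->
  (forall x y, Omega x -> Omega y ->
    enorm (grad f x - grad f y) <= L * enorm (x - y)) ->
  Omega x -> d <> 0 -> 0 <= a ->
  (forall t, 0 <= t <= a -> Omega (y + t *: d) /\
     eball x (dotp (- grad f x) (normalize d) / L) (y + t *: d)) ->
  f (y + a *: d) <= f y.
Proof.
move=> L0 df lip Ox d0 a0 seg.
have seg1 t : 0 <= t <= 1 -> 0 <= t * a <= a.
  by move=> /andP[t0 t1]; rewrite mulr_ge0//= ler_piMl.
suff : f (y + a *: d) <= f y + 0 + 0 / 2 by rewrite mul0r !addr0.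
apply: le_along_segment => t t01; rewrite scalerA;
  have [Ot tball] := seg _ (seg1 t t01).
  exact: df.
rewrite mul0r addr0 dotpZr mulr_ge0_le0//.
rewrite -[grad f (_ + _)](subrK (grad f x)) dotpDl.
have := cauchy_schwarz (grad f (y + (t * a) *: d) - grad f x) d.
have := dotp_normalize (- grad f x) d0; rewrite [RHS]dotpNl.
have h := lip _ _ Ot Ox.
move: tball; rewrite /eball /= ler_pdivlMr// mulrC => /(le_trans h) {}h.
have := ler_wpM2r (enorm_ge0 d) h; lra.
Qed.

(** * Runs of the procedure *)

(** For r = L |z - x|, with z the output of the run, these are the properties that
qualify [w] as the intermediate point of the theorem. Along the run r is instead
a slope <g, d> / |d|. *)
Definition anchor (R : realType) (n : nat) (Omega : set 'rV[R]_n)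
    (A : 'rV[R]_n -> 'rV[R]_n -> set 'rV[R]_n) (L : R) (x g w : 'rV[R]_n)
    (r : R) : Prop :=
  [/\ Omega w, L * enorm (w - x) ^+ 2 <= dotp g (w - x),
      L * enorm (w - x) <= r & SB A Omega * tproj_norm Omega w g <= r].

Lemma anchorW (R : realType) (n : nat) (Omega : set 'rV[R]_n)
    (A : 'rV[R]_n -> 'rV[R]_n -> set 'rV[R]_n) (L : R) (x g w : 'rV[R]_n)
    (r r' : R) :
  r <= r' -> anchor Omega A L x g w r -> anchor Omega A L x g w r'.
Proof. by move=> rr' [Ow wball wr pr]; split => //; apply: le_trans rr'. Qed.

Lemma anchor_slope (R : realType) (n : nat) (Omega : set 'rV[R]_n)
    (A : 'rV[R]_n -> 'rV[R]_n -> set 'rV[R]_n) (L : R) (x g y d : 'rV[R]_n) :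
  0 < L -> is_method Omega A -> Omega y -> A y g d -> d <> 0 ->
  ssc_region L x g d y -> anchor Omega A L x g y (dotp g (normalize d)).
Proof.
move=> L0 mA Oy Ad d0 [/(mem_gradient_ball _ _ _ L0) yball].
rewrite /eball /= ler_pdivlMr// mulrC => yr.
by split => //; have [] := method_slope mA Oy Ad d0.
Qed.

(** The threshold [r] is the smallest slope used so far and [w] the iterate where
it was used; the last inequality survives a step because both the new slope and
the old one are at least the new minimum. *)
Definition run_invariant (R : realType) (n : nat) (Omega : set 'rV[R]_n)
    (A : 'rV[R]_n -> 'rV[R]_n -> set 'rV[R]_n) (f : 'rV[R]_n -> R) (L : R)
    (x g y : 'rV[R]_n) : Prop :=
  [/\ Omega y, L * enorm (y - x) ^+ 2 <= dotp g (y - x) &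
      y = x \/ exists w r, [/\ anchor Omega A L x g w r, f y <= f w &
                               r * enorm (y - x) <= dotp g (y - x)]].

Lemma run_invariant_step (R : realType) (n : nat) (Omega : set 'rV[R]_n)
    (A : 'rV[R]_n -> 'rV[R]_n -> set 'rV[R]_n) (f : 'rV[R]_n -> R) (L : R)
    (x y d : 'rV[R]_n) (a b : R) :
  0 < L -> (forall x, Omega x -> differentiable f x) ->
  (forall x y, Omega x -> Omega y ->
    enorm (grad f x - grad f y) <= L * enorm (x - y)) ->
  is_method Omega A -> Omega x ->
  let g := - grad f x in
  run_invariant Omega A f L x g y -> A y g d -> d <> 0 ->
  ssc_region L x g d y -> is_beta L x g y d b ->
  0 <= a <= b -> (forall t, 0 <= t <= a -> Omega (y + t *: d)) ->
  run_invariant Omega A f L x g (y + a *: d).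
Proof.
move=> L0 df lip mA Ox g [Oy yball yanch] Ad d0 yin betab ab Oseg.
have /andP[a0 a_le_b] := ab.
have [[_ ybin] _] := betab.1 yin.
have seg t : 0 <= t <= b -> ssc_region L x g d (y + t *: d).
  move=> tb; case: yin ybin => y1 y2 [yb1 yb2].
  by split; apply: eball_segment tb _ _.
have dec : f (y + a *: d) <= f y.
  apply: slope_nonincreasing L0 df lip Ox d0 a0 _ => t ta; split; first exact: Oseg.
  have /andP[t0 ta'] := ta.
  have [] // : ssc_region L x g d (y + t *: d).
  by apply: seg; rewrite t0 (le_trans ta').
split; first by apply: Oseg; rewrite a0 lexx.
  by have [/(mem_gradient_ball _ _ _ L0)] := seg _ ab.
right; set c := dotp g (normalize d).
have ancy : anchor Omega A L x g y c by exact: anchor_slope.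
have step_eq : y + a *: d - x = (y - x) + a *: d by rewrite addrAC.
have tri : enorm (y + a *: d - x) <= enorm (y - x) + a * enorm d.
  by rewrite step_eq -enormZ// enorm_triangle.
have gain : dotp g (y + a *: d - x) = dotp g (y - x) + a * (c * enorm d).
  by rewrite step_eq dotpDr dotpZr dotp_normalize.
have c0 : 0 <= c.
  by case: ancy => _ _ h _; apply: le_trans h; rewrite mulr_ge0 ?enorm_ge0 ?ltW.
(* The current iterate becomes the anchor when its slope is the smaller one. *)
have anew : c * enorm (y - x) <= dotp g (y - x) ->
  exists w r, [/\ anchor Omega A L x g w r, f (y + a *: d) <= f w &
                  r * enorm (y + a *: d - x) <= dotp g (y + a *: d - x)].
  move=> h; exists y, c; split => //.
  by rewrite gain; have := ler_wpM2l c0 tri; lra.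
case: yanch => [yx|[w [r [ancw fw rw]]]].
  by apply: anew; rewrite yx subrr enorm0 dotp0r mulr0.
have [cr|/ltW rc] := leP c r.
  by apply: anew; apply: le_trans rw; rewrite ler_wpM2r ?enorm_ge0.
exists w, r; split => //; first exact: le_trans dec fw.
have r0 : 0 <= r.
  by case: ancw => _ _ h _; apply: le_trans h; rewrite mulr_ge0 ?enorm_ge0 ?ltW.
rewrite gain; have := ler_wpM2l r0 tri.
have : r * (a * enorm d) <= c * (a * enorm d).
  by rewrite ler_wpM2r// mulr_ge0 ?enorm_ge0.
lra.
Qed.

(** A stationary iterate is its own anchor since its projected norm is 0; so is an
iterate outside the second ball, because the slope is then below L |y - x|. The
two remaining outcomes end with a step of length beta, possibly 0, whose endpoint
is on the boundary of one of the balls. *)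
Lemma ssc_output_anchor (R : realType) (n : nat) (Omega : set 'rV[R]_n)
    (A : 'rV[R]_n -> 'rV[R]_n -> set 'rV[R]_n) (f : 'rV[R]_n -> R) (L : R)
    (x z : 'rV[R]_n) :
  0 < L -> (forall x, Omega x -> differentiable f x) ->
  (forall x y, Omega x -> Omega y ->
    enorm (grad f x - grad f y) <= L * enorm (x - y)) ->
  is_method Omega A -> Omega x ->
  let g := - grad f x in
  ssc_output A Omega L x g z ->
  [/\ Omega z, L * enorm (z - x) ^+ 2 <= dotp g (z - x) &
      exists2 w, anchor Omega A L x g w (L * enorm (z - x)) & f z <= f w].
Proof.
move=> L0 df lip mA Ox g out.
(* A step of full length beta; beta = 0 covers blocked iterates of the region. *)
have exit y d b : run_invariant Omega A f L x g y -> A y g d -> d <> 0 ->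
    ssc_region L x g d y -> is_beta L x g y d b ->
    (forall t, 0 <= t <= b -> Omega (y + t *: d)) ->
    let z := y + b *: d in
    [/\ Omega z, L * enorm (z - x) ^+ 2 <= dotp g (z - x) &
      exists2 w, anchor Omega A L x g w (L * enorm (z - x)) & f z <= f w].
  move=> inv Ad d0 yin betab Oseg z'; have [Oy yball _] := inv.
  have [gd0 _] := method_slope mA Oy Ad d0.
  have [[b0 ybin] _] := betab.1 yin.
  have bb : 0 <= b <= b by rewrite b0 lexx.
  have [Oz zball zanch] :=
    run_invariant_step L0 df lip mA Ox inv Ad d0 yin betab bb Oseg.
  split => //.
  have [far|[zx sphere]] := is_beta_active L0 gd0 yin betab.
    exists y; first apply: anchorW (anchor_slope L0 mA Oy Ad d0 yin).
      by rewrite mulrC -ler_pdivrMr.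
    apply: slope_nonincreasing L0 df lip Ox d0 b0 _ => t tb; split; first exact: Oseg.
    case: yin ybin => _ y2 [_ yb2]; exact: eball_segment tb y2 yb2.
  case: zanch => [/zx //|[w [r [ancw fw rz]]]].
  exists w => //; apply: anchorW ancw.
  have zx0 : 0 < enorm (z' - x) by apply/enorm_gt0 => /eqP; rewrite subr_eq0 => /eqP.
  by rewrite -(ler_pM2r zx0) (le_trans rz)// (le_trans sphere)// expr2 mulrA.
have : run_invariant Omega A f L x g x.
  by split => //; [rewrite subrr enorm0 expr0n mulr0 dotp0r|left].
move: out; rewrite /ssc_output.
move: {2 4}x => y0 out; elim: out => {y0 z} [y A0|
    y d am b Ad d0 [am0 Oseg] betab amb|
    y d am b Ad d0 [am0 Oseg] betab amb_n0 amb|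
    y d am b z Ad d0 [am0 Oseg] betab amb_n0 amb _ IH] inv; have [Oy yball _] := inv.
- split => //; exists y => //; split => //.
  have [_ _ _ nA0] := mA y g Oy.
  have -> : tproj_norm Omega y g = 0 by apply/eqP/negPn/negP => /eqP /nA0.
  by rewrite mulr0 mulr_ge0 ?enorm_ge0 ?ltW.
- have b0 : b = 0.
    move: amb; rewrite minEle; case: ifP => // _ am_0.
    by move: am0; rewrite am_0 ltxx.
  have [yin|yout] := pselect (ssc_region L x g d y).
    have := exit y d b inv Ad d0 yin betab.
    rewrite b0 scale0r addr0; apply => t /andP[t0 tb]; apply: Oseg.
    by rewrite t0 (le_trans tb)// ltW.
  split => //; exists y => //; split => //.
  have [_ slope] := method_slope mA Oy Ad d0.
  apply: (le_trans slope); rewrite mulrC -ler_pdivrMr// leNgt; apply/negP => near_x.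
  by apply: yout; split; [exact/mem_gradient_ball|exact: ltW].
- have yin : ssc_region L x g d y.
    by apply: contrapT => /betab.2 b0; move: amb_n0; rewrite amb b0.
  rewrite amb; apply: exit => // t /andP[t0 tb]; apply: Oseg.
  by rewrite t0 (le_trans tb)// -amb ge_min lexx.
- have yin : ssc_region L x g d y.
    apply: contrapT => /betab.2 b0; move: amb_n0.
    by rewrite b0 min_r// ltW.
  have [[b0 _] _] := betab.1 yin.
  have m0 : 0 <= Num.min am b by rewrite le_min b0 ltW.
  apply: IH; apply: (run_invariant_step L0 df lip mA Ox inv Ad d0 yin betab).
    by rewrite m0 ge_min lexx orbT.
  by move=> t /andP[t0 tm]; apply: Oseg; rewrite t0 (le_trans tm)// ge_min lexx.
Qed.

Unset Implicit Arguments.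

(** * Sufficient decrease *)

Theorem proposition4p1 (R : realType) (n : nat) (Omega : set 'rV[R]_n)
    (f : 'rV[R]_n -> R) (L : R) (A : 'rV[R]_n -> 'rV[R]_n -> set 'rV[R]_n)
    (xk xtr : 'rV[R]_n)
    (Omega_nonempty : Omega !=set0)
    (Omega_compact : compact Omega)
    (Omega_convex : convex_set (Omega : set (convex_lmodType 'rV[R]_n)))
    (L_gt0 : 0 < L)
    (f_C1 : C1_on Omega f)
    (f_Lip : forall x y, Omega x -> Omega y ->
      enorm (grad f x - grad f y) <= L * enorm (x - y))
    (A_method : is_method Omega A)
    (SB_gt0 : 0 < SB A Omega)
    (xk_in : Omega xk)
    (xtr_out : ssc_output A Omega L xk (- grad f xk) xtr) :
  let tau := SB A Omega in
  let K := tau / (L * (1 + tau)) in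
  let a := L / 2 in
  let b := 1 / K in
  exists xt : 'rV[R]_n,
    [/\ Omega xt,
        f xtr <= f xt,
        f xt <= f xk - L / 2 * enorm (xk - xt) ^+ 2,
        f xk - f xtr >= L / 2 * enorm (xk - xtr) ^+ 2
      & enorm (xk - xtr) >= K * enorm (eproj (tangent_cone Omega xt) (- grad f xt))]
    /\
    forall xk1 : 'rV[R]_n, Omega xk1 ->
      f xk1 <= Num.min (f xtr) (f xk - L / 2 * enorm (xk1 - xk) ^+ 2) ->
      [/\ f xk1 + a * enorm (xk1 - xk) ^+ 2 <= f xk,
          f xk - f xk1 >=
            a / b ^+ 2 * enorm (eproj (tangent_cone Omega xt) (- grad f xt)) ^+ 2,
          f xk1 <= f xt
        & f xt <= f xk - a * enorm (xt - xk) ^+ 2].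
Proof.
have [f_diff _] := f_C1.
have [Oz zball [w [Ow wball wr wpi] fzw]] :=
  ssc_output_anchor L_gt0 f_diff f_Lip A_method xk_in xtr_out.
move=> tau K a b.
have tau0 : 0 < tau by [].
have decr y : Omega y -> L * enorm (y - xk) ^+ 2 <= dotp (- grad f xk) (y - xk) ->
    f y <= f xk - L / 2 * enorm (xk - y) ^+ 2.
  move=> Oy; rewrite dotpNl (enorm_distC xk).
  by have := descent_lemma Omega_convex f_diff f_Lip xk_in Oy; lra.
have fw := decr w Ow wball.
have fz := decr xtr Oz zball.
have K0 : 0 < K by rewrite divr_gt0// mulr_gt0//; lra.
have far : K * enorm (eproj (tangent_cone Omega w) (- grad f w)) <=
    enorm (xk - xtr).
  rewrite (enorm_distC xk) -/(tproj_norm Omega w (- grad f w)).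
  have := tproj_norm_le (- grad f w) (- grad f xk) Ow.
  rewrite -opprD enormN.
  have := f_Lip w xk Ow xk_in.
  move: wpi wr; rewrite -/tau.
  move: (tproj_norm Omega w (- grad f w)) (tproj_norm Omega w (- grad f xk)) => p q.
  move: (enorm (xtr - xk)) => D tq Lw gw pq.
  rewrite /K mulrAC ler_pdivrMr ?mulr_gt0//; last by lra.
  have : tau * p <= tau * (q + L * D) by rewrite ler_pM2l//; lra.
  lra.
exists w; split; first by split=> //; lra.
move=> xk1 O1; rewrite le_min => /andP[le_tr le_suff]; split; rewrite /a.
- by lra.
- have -> : L / 2 / b ^+ 2 = L / 2 * K ^+ 2 by rewrite /b div1r exprVn invrK.
  rewrite -mulrA -exprMn.
  have : L / 2 * (K * enorm (eproj (tangent_cone Omega w) (- grad f w))) ^+ 2 <=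
      L / 2 * enorm (xk - xtr) ^+ 2.
    rewrite ler_pM2l ?divr_gt0// ler_sqr ?nnegrE ?enorm_ge0//.
    by rewrite mulr_ge0 ?enorm_ge0// ltW.
  by lra.
- exact: le_trans le_tr fzw.
- by rewrite (enorm_distC w).
Qed.
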